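(* Each of the forgetful functors $U_{PQ}:\mathbf{PAb}\to\mathbf{QAb}$, $U_{PQ}^i:\mathbf{PAb}^i\to\mathbf{QAb}^i$ and $U_{PQ}^m:\mathbf{PAb}^m\to\mathbf{QAb}^m$ is a right adjoint (i.e., has a left adjoint).
   Context: A quasi-order is a reflexive and transitive relation. An abelian qo-group $(G,\preceq)$ is an abelian group $G$ (written additively) with a translation-invariant quasi-order $\preceq$ ($a\preceq b$ implies $a+c\preceq b+c$). It is an abelian po-group if $\preceq$ is a partial order. $\mathbf{QAb}$ and $\mathbf{PAb}$ are the categories of abelian qo-groups and abelian po-groups, with order-preserving group homomorphisms. The positive cone of $(G,\preceq)$ is the submonoid $G_0^+=\{g\in G:0\preceq g\}$. For a group $G$ (possibly ordered), $U'G$ is its underlying monoid. $\mathbf{QAb}^i$ is the category whose objects are the inclusions $\tau_G:G_0^+\hookrightarrow U'G$ of positive cones, one for each abelian qo-group $G$, and whose morphisms $\tau_G\to\tau_H$ are the commuting squares $(U'f,Cf)$ induced by order-preserving group homomorphisms $f:G\to H$, where $Cf:G_0^+\to H_0^+$ is the restriction of $f$; composition is componentwise. $\mathbf{PAb}^i$ is the full subcategory of $\mathbf{QAb}^i$ on those $\tau_G$ with $G$ an abelian po-group. $\mathbf{QAb}^m$ is the category whose objects are injective monoid homomorphisms $i:M\to U'G$, with $M$ a monoid and $G$ an abelian group, and whose morphisms $(i:M\to U'G)\to(j:N\to U'H)$ are pairs $(f_1,f_2)$ with $f_1:G\to H$ a group homomorphism and $f_2:M\to N$ a monoid homomorphism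 such that $j\circ f_2=U'f_1\circ i$, composed componentwise. A cancellative monoid $M$ is conical if its group of units $M^*$ is trivial. $\mathbf{PAb}^m$ is the full subcategory of $\mathbf{QAb}^m$ on the objects $i:M\to U'G$ with $M$ conical. The three forgetful functors are the evident inclusions. *)

(* Defs.v *)
From HB Require Import structures.
From mathcomp Require Import all_boot all_order all_algebra.
From mathcomp Require Import boolp.

Set Implicit Arguments.
Unset Strict Implicit.
Unset Printing Implicit Defensive.

Import GRing.Theory.

Local Open Scope ring_scope.

Record category := Category {
  obj :> Type;
  hom : obj -> obj -> Type;
  idm : forall x, hom x x;
  cmp : forall x y z, hom y z -> hom x y -> hom x z;
  cmp1m : forall x y (f : hom x y), cmp (idm y) f = f;
  cmpm1 : forall x y (f : hom x y), cmp f (idm x) = f;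
  cmpA : forall x y z t (h : hom z t) (g : hom y z) (f : hom x y),
    cmp h (cmp g f) = cmp (cmp h g) f
}.

Arguments hom {c} x y.
Arguments idm {c} x.
Arguments cmp {c x y z} g f.

Notation "g ∘ f" := (cmp g f) (at level 40, left associativity).

Record functor (C D : category) := Functor {
  fobj :> C -> D;
  fmap : forall x y : C, hom x y -> hom (fobj x) (fobj y);
  fmap1 : forall x : C, fmap (idm x) = idm (fobj x);
  fmapM : forall (x y z : C) (g : hom y z) (f : hom x y),
    fmap (g ∘ f) = fmap g ∘ fmap f
}.

Arguments fmap {C D} f {x y} _ : rename.

Record adjunction (C D : category) (L : functor D C) (R : functor C D) :=
  Adjunction {
  adj : forall (x : D) (y : C), hom (L x) y -> hom x (R y);
  adj_bij : forall (x : D) (y : C), bijective (@adj x y);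
  adj_natl : forall (x x' : D) (y : C) (g : hom (L x) y) (h : hom x' x),
    adj (g ∘ fmap L h) = adj g ∘ h;
  adj_natr : forall (x : D) (y y' : C) (k : hom y y') (g : hom (L x) y),
    adj (k ∘ g) = fmap R k ∘ adj g
}.

Definition is_right_adjoint (C D : category) (R : functor C D) : Prop :=
  exists L : functor D C, inhabited (adjunction L R).

Section FullSubcategory.
Variables (C : category) (P : C -> Prop).

Definition full_sub : category :=
  @Category {x : C | P x} (fun x y => hom (sval x) (sval y))
    (fun x => idm (sval x)) (fun x y z g f => g ∘ f)
    (fun x y f => cmp1m f) (fun x y f => cmpm1 f)
    (fun x y z t h g f => cmpA h g f).

Definition full_incl : functor full_sub C :=
  @Functor full_sub C sval (fun x y f => f)
    (fun x => erefl) (fun x y z g f => erefl).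

End FullSubcategory.

(* Boolean relations and the choice structure carried by a zmodType (or a
   monoidType) are no restriction under the classical axioms of boolp *)
Record qoGroup := QoGroup {
  qo_sort :> zmodType;
  qo_le : rel qo_sort;
  qo_refl : reflexive qo_le;
  qo_trans : transitive qo_le;
  qo_leD2r : forall c a b, qo_le a b -> qo_le (a + c) (b + c)
}.

Definition is_poGroup (G : qoGroup) : Prop := antisymmetric (@qo_le G).

Record qoHom (G H : qoGroup) := QoHom {
  qo_fun :> {additive G -> H};
  qo_homo : {homo qo_fun : a b / qo_le a b}
}.

Lemma additiveP (U V : zmodType) (f g : {additive U -> V}) : f =1 g -> f = g.
Proof.
case: f g => [f [[cf]]] [g [[cg]]] /= /funext fg; subst g.
by rewrite (Prop_irrelevance cf cg).
Qed.

Lemma monHomP (M N : monoidType) (f g : UMagmaMorphism.type M N) :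
  f =1 g -> f = g.
Proof.
case: f g => [f [[cf1] [cf2]]] [g [[cg1] [cg2]]] /= /funext fg; subst g.
by rewrite (Prop_irrelevance cf1 cg1) (Prop_irrelevance cf2 cg2).
Qed.

Lemma qoHomP (G H : qoGroup) (f g : qoHom G H) : f =1 g -> f = g.
Proof.
case: f g => [f pf] [g pg] /= /additiveP fg; subst g.
by rewrite (Prop_irrelevance pf pg).
Qed.

Definition qo_id (G : qoGroup) : qoHom G G :=
  @QoHom G G (idfun : {additive G -> G}) (fun _ _ le_ab => le_ab).

Definition qo_comp (G H K : qoGroup) (g : qoHom H K) (f : qoHom G H) :
    qoHom G K :=
  @QoHom G K (g \o f : {additive G -> K})
    (fun _ _ le_ab => qo_homo g (qo_homo f le_ab)).

Program Definition QAb : category :=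
  @Category qoGroup qoHom qo_id qo_comp _ _ _.
Next Obligation. exact: qoHomP. Qed.
Next Obligation. exact: qoHomP. Qed.
Next Obligation. exact: qoHomP. Qed.

Definition PAb : category := @full_sub QAb is_poGroup.

Definition U_PQ : functor PAb QAb := @full_incl QAb is_poGroup.

Notation monHom := UMagmaMorphism.type.

(* The underlying monoid U'G is [Algebra.to_multiplicative G]: the monoid with
   the same elements as G, whose product is the addition of G *)
Notation Umon := Algebra.to_multiplicative.

Definition UmonHom (G H : zmodType) (f : {additive G -> H}) :
  monHom (Umon G) (Umon H) := Algebra.to_fmultiplicative f.

Section PositiveCone.
Variable G : qoGroup.

Definition pos : pred (Umon G) := fun g => qo_le 0 g.

Lemma pos_closed : umagma_closed pos.
Proof.
split=> [|a b]; first exact: qo_refl.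
rewrite !unfold_in /pos => a_ge0 b_ge0; apply: qo_trans b_ge0 _.
by rewrite -{1}[b]add0r; exact: qo_leD2r.
Qed.

Definition cone := {g : Umon G | pos g}.

HB.instance Definition _ := SubChoice.on cone.

HB.instance Definition _ :=
  SubChoice_isSubMonoid.Build (Umon G) pos cone pos_closed.

Definition tau : monHom cone (Umon G) := val.

End PositiveCone.

Section ConeHom.
Variables (G H : qoGroup) (f : qoHom G H).

Lemma cone_hom_subproof (x : cone G) : pos (f (val x) : Umon H).
Proof. by case: x => x x_ge0; rewrite /pos -(raddf0 f); exact: qo_homo. Qed.

Definition cone_fun (x : cone G) : cone H :=
  exist _ (f (val x) : Umon H) (cone_hom_subproof x).

Lemma cone_fun_morph : monoid.monoid_morphism cone_fun.
Proof.
by split=> [|x y]; apply: val_inj; [exact: raddf0 | exact: raddfD].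
Qed.

HB.instance Definition _ :=
  isUMagmaMorphism.Build (cone G) (cone H) cone_fun cone_fun_morph.

Definition coneHom : monHom (cone G) (cone H) := cone_fun.

End ConeHom.

Definition monId (M : monoidType) : monHom M M := idfun.

Definition monComp (M N P : monoidType) (g : monHom N P) (f : monHom M N) :
  monHom M P := g \o f.

Record monArrow := MonArrow {
  src : monoidType;
  tgt : monoidType;
  arr : monHom src tgt
}.

Record square (a b : monArrow) := Square {
  sq_tgt : monHom (tgt a) (tgt b);
  sq_src : monHom (src a) (src b);
  sq_comm : arr b \o sq_src =1 sq_tgt \o arr a
}.

Lemma squareP (a b : monArrow) (s t : square a b) :
  sq_tgt s =1 sq_tgt t -> sq_src s =1 sq_src t -> s = t.
Proof.
case: s t => [s1 s2 ps] [t1 t2 pt] /= /monHomP s1t1 /monHomP s2t2.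
by subst t1 t2; rewrite (Prop_irrelevance ps pt).
Qed.

Definition sq_id (a : monArrow) : square a a :=
  @Square a a (monId (tgt a)) (monId (src a)) (fun=> erefl).

Program Definition sq_comp (a b c : monArrow) (s : square b c)
    (t : square a b) : square a c :=
  @Square a c (monComp (sq_tgt s) (sq_tgt t)) (monComp (sq_src s) (sq_src t)) _.
Next Obligation.
move=> x /=.
by rewrite -[RHS](congr1 (sq_tgt s) (sq_comm t x)); exact: sq_comm.
Qed.

Definition tauArrow (G : qoGroup) : monArrow := MonArrow (tau G).

Definition induced_square (G H : qoGroup) (f : qoHom G H) :
    square (tauArrow G) (tauArrow H) :=
  @Square (tauArrow G) (tauArrow H) (UmonHom f) (coneHom f) (fun=> erefl).

Definition induced (G H : qoGroup) (s : square (tauArrow G) (tauArrow H)) :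
  Prop := exists f : qoHom G H, s = induced_square f.

Lemma induced_id (G : qoGroup) : induced (sq_id (tauArrow G)).
Proof. by exists (qo_id G); apply: squareP => // x; exact: val_inj. Qed.

Lemma induced_comp (G H K : qoGroup) (s : square (tauArrow H) (tauArrow K))
    (t : square (tauArrow G) (tauArrow H)) :
  induced s -> induced t -> induced (sq_comp s t).
Proof.
move=> [g ->] [f ->]; exists (qo_comp g f).
by apply: squareP => // x; exact: val_inj.
Qed.

(* An abelian qo-group G, as an object of QAbi, stands for the arrow tau G;
   since the quasi-order is determined by the positive cone, distinct
   qo-groups have distinct inclusions *)
Program Definition QAbi : category :=
  @Category qoGroup
    (fun G H => {s : square (tauArrow G) (tauArrow H) | induced s})
    (fun G => exist _ (sq_id (tauArrow G)) (induced_id G))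
    (fun G H K s t => exist _ (sq_comp (sval s) (sval t))
                              (induced_comp (svalP s) (svalP t)))
    _ _ _.
Next Obligation. by apply: eq_exist; exact: squareP. Qed.
Next Obligation. by apply: eq_exist; exact: squareP. Qed.
Next Obligation. by apply: eq_exist; exact: squareP. Qed.

Definition PAbi : category := @full_sub QAbi is_poGroup.

Definition U_PQ_i : functor PAbi QAbi := @full_incl QAbi is_poGroup.

Record monEmb := MonEmb {
  me_mon : monoidType;
  me_grp : zmodType;
  me_inc : monHom me_mon (Umon me_grp);
  me_inj : injective me_inc
}.

Record meHom (i j : monEmb) := MeHom {
  me_fst : {additive me_grp i -> me_grp j};
  me_snd : monHom (me_mon i) (me_mon j);
  me_comm : me_inc j \o me_snd =1 UmonHom me_fst \o me_inc i
}.

Lemma meHomP (i j : monEmb) (f g : meHom i j) :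
  me_fst f =1 me_fst g -> me_snd f =1 me_snd g -> f = g.
Proof.
case: f g => [f1 f2 pf] [g1 g2 pg] /= /additiveP f1g1 /monHomP f2g2.
by subst g1 g2; rewrite (Prop_irrelevance pf pg).
Qed.

Definition me_id (i : monEmb) : meHom i i :=
  @MeHom i i (idfun : {additive me_grp i -> me_grp i}) (monId (me_mon i))
    (fun=> erefl).

Program Definition me_comp (i j k : monEmb) (g : meHom j k) (f : meHom i j) :
    meHom i k :=
  @MeHom i k (me_fst g \o me_fst f : {additive me_grp i -> me_grp k})
    (monComp (me_snd g) (me_snd f)) _.
Next Obligation.
move=> x /=.
by rewrite -[RHS](congr1 (me_fst g) (me_comm f x)); exact: me_comm.
Qed.

Program Definition QAbm : category :=
  @Category monEmb meHom me_id me_comp _ _ _.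
Next Obligation. exact: meHomP. Qed.
Next Obligation. exact: meHomP. Qed.
Next Obligation. exact: meHomP. Qed.

Definition mon_unit (M : monoidType) (x : M) : Prop :=
  exists y : M, (x * y = 1)%g /\ (y * x = 1)%g.

(* Conicality is meant for cancellative monoids; a monoid that embeds in a
   group, as in QAbm, is always cancellative *)
Definition conical (M : monoidType) : Prop :=
  forall x : M, mon_unit x -> x = 1%g.

Definition is_conicalEmb (i : monEmb) : Prop := conical (me_mon i).

Definition PAbm : category := @full_sub QAbm is_conicalEmb.

Definition U_PQ_m : functor PAbm QAbm := @full_incl QAbm is_conicalEmb.

(* Main.v *)
From HB Require Import structures.
From mathcomp Require Import all_boot all_algebra.
From mathcomp Require Import boolp.
Require Import Defs.

Set Implicit Arguments.
Unset Strict Implicit.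
Unset Printing Implicit Defensive.

Import GRing.Theory.

Local Open Scope ring_scope.
Local Open Scope quotient_scope.

(** Each of the three functors is the inclusion of a full subcategory, so it
    is a right adjoint as soon as every object x of the ambient category has a
    reflection: a universal morphism from x to an object of the subcategory
    ([reflective_right_adjoint]).

    In all three cases the reflection kills a subgroup of the ambient group.
    The failure of antisymmetry in a qo-group G is measured by the subgroup N of
    those g with 0 <= g <= 0. The quasi-order descends to G/N, where it becomes
    antisymmetric, and an order-preserving map f to a po-group satisfies
    0 <= f(g) <= 0, hence f(g) = 0, for g in N; so f factors uniquely through
    G/N ([poGroup_reflective]).

    Sending a qo-group to the inclusion of its positive cone is an isomorphism
    of categories which identifies the po-groups on both sides, so the second
    statement is the first one transported ([reflective_transport],
    [cone_functor_bij]).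

    For an embedding i : M -> G the same role is played by N = i(M^* ), the image
    of the units of M. The reflection is the image of M in G/N. It is
    conical: if the classes of m and n are opposite, then i(m n) lies in N, so
    m n is a unit of M; as M is commutative (it embeds in G), m is a unit and
    its class is trivial. A morphism to a conical embedding sends units of M to
    the neutral element, so its group component factors through G/N, and the
    factorization sends the class of i(m) to the image of m in the target
    ([conicalEmb_reflective]). *)

(** * Reflective full subcategories *)

Definition is_reflection (C : category) (P : C -> Prop) (x r : C)
    (eta : hom x r) : Prop :=
  P r /\ forall y : C, P y -> forall f : hom x y, exists! g, g ∘ eta = f.

Definition reflective (C : category) (P : C -> Prop) : Prop :=
  forall x : C, exists (r : C) (eta : hom x r), is_reflection P eta.

(** Universal morphisms, chosen for every object, assemble into a left adjoint:
    its action on a morphism f is the unique extension of eta f, and uniqueness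
    of extensions gives functoriality. *)
Lemma reflective_right_adjoint (C : category) (P : C -> Prop) :
  reflective P -> is_right_adjoint (full_incl P).
Proof.
move=> reflP.
pose r x := sval (cid (reflP x)).
pose eta x : hom x (r x) := sval (cid (svalP (cid (reflP x)))).
have etaP x : is_reflection P (eta x) := svalP (cid (svalP (cid (reflP x)))).
pose ext x y (Py : P y) (f : hom x y) : hom (r x) y :=
  sval (cid ((etaP x).2 y Py f)).
have extE x y (Py : P y) f : ext x y Py f ∘ eta x = f.
  by have [] := svalP (cid ((etaP x).2 y Py f)).
have eta_inj x y (Py : P y) (g h : hom (r x) y) :
    g ∘ eta x = h ∘ eta x -> g = h.
  move=> gh; have [k [_ kU]] := (etaP x).2 y Py (h ∘ eta x).
  by rewrite -(kU g gh) -(kU h erefl).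
pose Lobj x : full_sub P := exist _ (r x) (etaP x).1.
pose Lmap x y (f : hom x y) : hom (Lobj x) (Lobj y) :=
  ext x (r y) (etaP y).1 (eta y ∘ f).
have Lmap1 x : Lmap x x (idm x) = idm (Lobj x).
  by apply: (eta_inj _ _ (etaP x).1); rewrite extE cmpm1 cmp1m.
have LmapM x y z (g : hom y z) (f : hom x y) :
    Lmap x z (g ∘ f) = Lmap y z g ∘ Lmap x y f.
  apply: (eta_inj _ _ (etaP z).1).
  by rewrite extE /= -cmpA extE !cmpA extE.
pose L : functor C (full_sub P) := Functor Lmap1 LmapM.
exists L; constructor.
apply: (@Adjunction _ _ L (full_incl P)
  (fun x y (g : hom (r x) (sval y)) => g ∘ eta x)) => /=.
- move=> x y; exists (ext x (sval y) (svalP y)) => [g|f]; last exact: extE.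
  by apply: (eta_inj _ _ (svalP y)); rewrite extE.
- by move=> x x' y g h; rewrite -cmpA extE cmpA.
- by move=> x y y' k g; rewrite cmpA.
Qed.

(** The image under F of a universal morphism is universal because F is bijective
    on morphisms. Objects are reached up to equality and not merely up to
    isomorphism, since Q may fail to be stable under isomorphism. *)
Lemma reflective_transport (C D : category) (P : C -> Prop) (Q : D -> Prop)
    (F : functor C D) :
  (forall y : D, exists x : C, fobj F x = y) ->
  (forall x y : C, bijective (fun f : hom x y => fmap F f)) ->
  (forall x : C, P x <-> Q (fobj F x)) ->
  reflective P -> reflective Q.
Proof.
move=> Fsurj Fff PQ reflP y; have [x <-] := Fsurj y.
have [r [eta [Pr etaU]]] := reflP x.
exists (fobj F r), (fmap F eta); split; first exact/PQ.
move=> z'; have [z <-] := Fsurj z' => /PQ Pz f.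
have [Fi FiK FK] := Fff x z; have [Gi GiK GK] := Fff r z.
have [g [gE gU]] := etaU z Pz (Fi f).
exists (fmap F g); split=> [|h hE]; first by rewrite -fmapM gE FK.
rewrite -[h]GK; congr (fmap F _); apply: gU.
by apply: (can_inj FiK); rewrite fmapM GK FK.
Qed.

(** * Quotients of abelian groups *)

(** The map g evaluates f at a representative, which is harmless because f is
    constant on classes. That g is the only such map follows, where needed, from
    surjectivity of the projection, that is, from [reprK]. *)
Lemma quot_factor (G H : zmodType) (N : zmodClosed G) (f : {additive G -> H}) :
  {in N, forall x, f x = 0} ->
  exists g : {additive Quotient.quot N -> H}, forall x, g (\pi x) = f x.
Proof.
move=> fN.
have f_class x y : \pi_(Quotient.quot N) x = \pi_(Quotient.quot N) y -> f x = f y.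
  move=> /eqP; rewrite -Quotient.idealrBE => /fN.
  by rewrite raddfB => /subr0_eq.
pose g (q : Quotient.quot N) := f (repr q).
have gE x : g (\pi x) = f x by apply: f_class; rewrite reprK.
have gB : zmod_morphism g.
  move=> p q; rewrite -[p]reprK -[q]reprK -raddfB !gE.
  exact: raddfB.
pose mg := GRing.isZmodMorphism.Build _ _ g gB.
by exists (HB.pack_for {additive Quotient.quot N -> H} g mg).
Qed.

(** * The po-group reflection of a qo-group *)

Section QuasiOrderedQuotient.
Variable G : qoGroup.

Definition qo_null : {pred G} := [pred a | qo_le 0 a & qo_le a 0].

Lemma qo_null_closed : zmod_closed qo_null.
Proof.
split=> [|a b]; first by rewrite inE qo_refl.
rewrite !inE => /andP[a_ge0 a_le0] /andP[b_ge0 b_le0].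
rewrite -(subrr b); apply/andP; split; apply: qo_leD2r.
- exact: qo_trans b_le0 a_ge0.
- exact: qo_trans a_le0 b_ge0.
Qed.

HB.instance Definition _ := GRing.isZmodClosed.Build G qo_null qo_null_closed.

Definition po_quot : zmodType := Quotient.quot qo_null.

(** Comparing chosen representatives is the same as comparing any of them, by
    [po_quot_leE]; reflexivity and transitivity are then immediate. *)
Definition po_quot_le : rel po_quot := [rel p q | qo_le (repr p) (repr q)].

Lemma repr_pi_null (a : G) : a - repr (\pi_po_quot a) \in qo_null.
Proof. by rewrite Quotient.idealrBE reprK. Qed.

(** An element and its representative differ by an element that is both
    nonnegative and nonpositive, so each is below the other. *)
Lemma po_quot_leE (a b : G) : po_quot_le (\pi a) (\pi b) = qo_le a b.
Proof.
have /andP[a1 a2] := repr_pi_null a; have /andP[b1 b2] := repr_pi_null b.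
move: (qo_leD2r (repr (\pi_po_quot a)) a1) (qo_leD2r (repr (\pi_po_quot a)) a2).
move: (qo_leD2r (repr (\pi_po_quot b)) b1) (qo_leD2r (repr (\pi_po_quot b)) b2).
rewrite !add0r !addrNK => b3 b4 a3 a4.
by apply/idP/idP => le_ab;
  [apply: qo_trans a4 (qo_trans le_ab b3) | apply: qo_trans a3 (qo_trans le_ab b4)].
Qed.

Lemma po_quot_le_refl : reflexive po_quot_le.
Proof. by move=> p; exact: qo_refl. Qed.

Lemma po_quot_le_trans : transitive po_quot_le.
Proof. by move=> q p s; exact: qo_trans. Qed.

Lemma po_quot_leD2r (c a b : po_quot) :
  po_quot_le a b -> po_quot_le (a + c) (b + c).
Proof.
rewrite -[a]reprK -[b]reprK -[c]reprK -!raddfD !po_quot_leE.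
exact: qo_leD2r.
Qed.

Definition po_reflection : qoGroup :=
  QoGroup po_quot_le_refl po_quot_le_trans po_quot_leD2r.

Lemma po_reflection_po : is_poGroup po_reflection.
Proof.
move=> p q /andP[pq qp]; rewrite -[p]reprK -[q]reprK.
apply/eqP; rewrite -Quotient.idealrBE inE -(subrr (repr q)).
by rewrite !qo_leD2r.
Qed.

Definition po_unit : qoHom G po_reflection :=
  @QoHom G po_reflection (\pi_po_quot : {additive G -> po_quot})
    (fun a b le_ab => etrans (po_quot_leE a b) le_ab).

End QuasiOrderedQuotient.

(** Antisymmetry of H forces f to vanish on [qo_null], and the induced map on the
    quotient preserves the order because the order was defined on
    representatives. *)
Lemma poGroup_reflective : @reflective QAb is_poGroup.
Proof.
move=> G; exists (po_reflection G), (po_unit G).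
split; first exact: po_reflection_po.
move=> /= H H_po f.
have fN : {in @qo_null G, forall a, f a = 0}.
  move=> a /andP[a_ge0 a_le0]; apply: H_po.
  by rewrite -(raddf0 f) !qo_homo.
have [g gE] := quot_factor fN.
have g_homo : {homo g : p q / @qo_le (po_reflection G) p q >-> qo_le p q}.
  by move=> p q pq; rewrite -[p]reprK -[q]reprK !gE; exact: qo_homo.
exists (@QoHom (po_reflection G) H g g_homo); split=> [|h hE].
  by apply: qoHomP => a; exact: gE.
by apply: qoHomP => p; rewrite -[p]reprK [LHS]gE -hE.
Qed.

(** * Transport to inclusions of positive cones *)

Program Definition cone_functor : functor QAb QAbi :=
  @Functor QAb QAbi id
    (fun G H f => exist _ (induced_square f) (ex_intro _ f erefl)) _ _.
Next Obligation.
by apply: eq_exist; apply: squareP => // a; exact: val_inj.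
Qed.
Next Obligation.
by apply: eq_exist; apply: squareP => // a; exact: val_inj.
Qed.

(** The underlying group homomorphism is the target component of the induced
    square, hence faithfulness; fullness is built into the morphisms of
    [QAbi]. *)
Lemma cone_functor_bij (G H : QAb) :
  bijective (fun f : hom G H => fmap cone_functor f).
Proof.
have inj : injective (fun f : hom G H => fmap cone_functor f).
  move=> f g fg; apply: qoHomP => a.
  exact: (congr1 (fun s : @hom QAbi G H => sq_tgt (sval s) a) fg).
have surj (s : @hom QAbi G H) : exists f : qoHom G H, fmap cone_functor f = s.
  case: s => s s_ind; have [f sE] := s_ind.
  by exists f; apply: eq_exist.
exists (fun s => sval (cid (surj s))) => [f|s]; last by case: cid.
by apply: inj; case: cid.
Qed.

(** * The conical reflection of a monoid embedded in a group *)

Section ConicalQuotient.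
Variable i : monEmb.

Lemma me_inc1 : me_inc i 1%g = 0 :> me_grp i.
Proof. exact: (@gmulf1 _ _ (me_inc i)). Qed.

Lemma me_incM (x y : me_mon i) :
  me_inc i (x * y)%g = me_inc i x + me_inc i y :> me_grp i.
Proof. exact: (@gmulfM _ _ (me_inc i)). Qed.

Definition unit_image : {pred me_grp i} :=
  [pred a | `[< exists2 u, mon_unit u & me_inc i u = a >]].

(** The difference of the images of two units u and v is the image of u v^-1. *)
Lemma unit_image_closed : zmod_closed unit_image.
Proof.
split=> [|a b].
  apply/asboolP; exists 1%g; last exact: me_inc1.
  by exists 1%g; rewrite mulg1.
move=> /asboolP[u [u' [uu' u'u]] <-] /asboolP[v [v' [vv' v'v]] <-].
apply/asboolP; exists (u * v')%g.
  exists (v * u')%g; split.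
    by rewrite mulgA -(mulgA u) v'v mulg1.
  by rewrite mulgA -(mulgA v) u'u mulg1.
apply/eqP; rewrite me_incM -subr_eq0 opprB addrC addrA subrK.
by rewrite -me_incM vv' me_inc1.
Qed.

HB.instance Definition _ :=
  GRing.isZmodClosed.Build (me_grp i) unit_image unit_image_closed.

Definition conical_quot : zmodType := Quotient.quot unit_image.

Definition mon_image : pred (Umon conical_quot) :=
  fun q => `[< exists m, \pi_conical_quot (me_inc i m) = q >].

Lemma mon_image_closed : umagma_closed mon_image.
Proof.
split=> [|p q].
  by apply/asboolP; exists 1%g; rewrite me_inc1 raddf0.
move=> /asboolP[m <-] /asboolP[n <-]; apply/asboolP.
by exists (m * n)%g; rewrite me_incM raddfD.
Qed.

Definition image_mon := {q : Umon conical_quot | mon_image q}.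

HB.instance Definition _ := SubChoice.on image_mon.

HB.instance Definition _ :=
  SubChoice_isSubMonoid.Build (Umon conical_quot) mon_image image_mon
    mon_image_closed.

Definition conical_reflection : monEmb :=
  @MonEmb image_mon conical_quot (val : monHom image_mon (Umon conical_quot))
    val_inj.

(** If the classes of m and n are inverse to each other, then m n is the unit u:
    its image lies in [unit_image] and the embedding is injective. Hence
    n u^-1 is a right inverse of m, and also a left one because M inherits
    commutativity from the group. *)
Lemma conical_reflection_conical : is_conicalEmb conical_reflection.
Proof.
move=> [p p_im] [[q q_im] [/(congr1 val) pq _]]; apply: val_inj => /=.
have /asboolP[m mE] := p_im; have /asboolP[n nE] := q_im.
have : me_inc i (m * n)%g \in unit_image.
  rewrite -[X in X \in _]subr0 Quotient.idealrBE raddf0 me_incM raddfD.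
  by apply/eqP; exact: etrans (congr2 +%R mE nE) pq.
move=> /asboolP[u [u' [uu' u'u]] /me_inj uE].
have mn : (m * (n * u') = 1)%g by rewrite mulgA -uE.
have nm : ((n * u') * m = 1)%g.
  by apply: (@me_inj i); rewrite [LHS]me_incM addrC -me_incM mn.
rewrite -mE; apply: etrans (raddf0 \pi_conical_quot).
apply/eqP; rewrite -Quotient.idealrBE.
by rewrite subr0; apply/asboolP; exists m => //; exists (n * u')%g.
Qed.

Definition image_proj (m : me_mon i) : image_mon :=
  exist _ (\pi_conical_quot (me_inc i m) : Umon conical_quot)
    (asboolT (ex_intro _ m erefl)).

Lemma image_proj_surj (q : image_mon) : exists m, image_proj m = q.
Proof.
by case: q => q q_im; have /asboolP[m mE] := q_im; exists m; apply: val_inj.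
Qed.

Lemma image_proj_morph : monoid.monoid_morphism image_proj.
Proof.
split=> [|m n]; apply: val_inj; rewrite /= ?me_inc1 ?me_incM.
- exact: raddf0.
- exact: raddfD.
Qed.

HB.instance Definition _ :=
  isUMagmaMorphism.Build (me_mon i) image_mon image_proj image_proj_morph.

Definition conical_unit : meHom i conical_reflection :=
  @MeHom i conical_reflection
    (\pi_conical_quot : {additive me_grp i -> conical_quot}) image_proj
    (fun=> erefl).

End ConicalQuotient.

Lemma monHom_mon_unit (M N : monoidType) (f : monHom M N) (u : M) :
  mon_unit u -> mon_unit (f u).
Proof.
by move=> [v [uv vu]]; exists (f v); rewrite -!gmulfM uv vu gmulf1.
Qed.

(** Since the target embedding is injective, the monoid component of a morphism
    is determined by the group component: it exists as soon as g sends the image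
    of one monoid into the image of the other, and its multiplicativity can be
    checked in the group. *)
Lemma meHom_lift (i j : monEmb) (g : {additive me_grp i -> me_grp j}) :
  (forall m, exists n, me_inc j n = g (me_inc i m)) ->
  exists h : meHom i j, me_fst h =1 g.
Proof.
move=> /choice[f fE].
have f_morph : monoid.monoid_morphism f.
  split=> [|m n]; apply: (@me_inj j).
    by rewrite fE me_inc1 raddf0 me_inc1.
  by rewrite fE me_incM raddfD [RHS]me_incM !fE.
pose mf := isUMagmaMorphism.Build _ _ f f_morph.
by exists (@MeHom i j g (HB.pack_for (monHom (me_mon i) (me_mon j)) f mf) fE).
Qed.

Lemma meHom_fst_inj (i j : monEmb) (f g : meHom i j) :
  me_fst f =1 me_fst g -> f = g.
Proof.
move=> fg; apply: meHomP => // m; apply: (@me_inj j).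
by rewrite [LHS](me_comm f) [RHS](me_comm g); exact: fg.
Qed.

(** A morphism to a conical embedding sends units to units, hence to 1, so its
    group component factors through the quotient; by [meHom_lift] the monoid
    component follows. *)
Lemma conicalEmb_reflective : @reflective QAbm is_conicalEmb.
Proof.
move=> i; exists (conical_reflection i), (conical_unit i).
split; first exact: conical_reflection_conical.
move=> /= j j_con f.
have fN : {in @unit_image i, forall a, me_fst f a = 0}.
  move=> _ /asboolP[u u_unit <-].
  rewrite -[LHS](me_comm f) /= (j_con _ (monHom_mon_unit (me_snd f) u_unit)).
  exact: me_inc1.
have [g gE] := quot_factor fN.
have [|h hE] := @meHom_lift (conical_reflection i) j g.
  move=> q; have [m <-] := image_proj_surj q.
  by exists (me_snd f m); rewrite [RHS]gE; exact: (me_comm f).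
exists h; split=> [|k kE].
  by apply: meHom_fst_inj => a /=; rewrite hE.
by apply: meHom_fst_inj => p; rewrite hE -[p]reprK [LHS]gE -kE.
Qed.

Theorem proposition3p13 :
  is_right_adjoint U_PQ /\ is_right_adjoint U_PQ_i /\ is_right_adjoint U_PQ_m.
Proof.
split; first exact: reflective_right_adjoint poGroup_reflective.
split; last exact: reflective_right_adjoint conicalEmb_reflective.
apply: (@reflective_right_adjoint QAbi is_poGroup).
apply: (reflective_transport (F := cone_functor)) poGroup_reflective => //.
- by move=> G; exists G.
- exact: cone_functor_bij.
Qed.
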